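(* Let $p$ be an odd prime, $m$ a positive integer, $q=p^m$, $u$ a positive integer and $v=\gcd(m,u)$. Let $\mathrm{Tr}$ denote the trace map from $\mathbb{F}_q$ to $\mathbb{F}_p$. Let \[ D_2=\{(x,y)\in\mathbb{F}_q^2\setminus\{(0,0)\} : \mathrm{Tr}(x^2+y^{p^u+1})=0\}, \] and $C_{D_2}=\{c(a,b)=(\mathrm{Tr}(ax+by))_{(x,y)\in D_2} : a,b\in\mathbb{F}_q\}$. Suppose $\frac{m}{v}$ is odd or $\frac{m}{v}\equiv 2\pmod 4$. Then $C_{D_2}$ is an $[n,2m]$ two-weight linear code over $\mathbb{F}_p$, where \[ n=\begin{cases}(p^m+1)(p^{m-1}-1), & \text{if } p\equiv 3\pmod 4 \text{ and } v \text{ is odd},\\ (p^m-1)(p^{m-1}+1), & \text{otherwise},\end{cases} \] with the following weight distribution. If $p\equiv 3\pmod 4$ and $v$ is odd: weight $0$ with multiplicity $1$; weight $(p-1)p^{2m-2}$ with multiplicity $(p^m+1)(p^{m-1}-1)$; weight $(p-1)p^{2m-2}\left(1-\frac{1}{p^{m-1}}\right)$ with multiplicity $(p^m+1)p^{m-1}(p-1)$. Otherwise: weight $0$ with multiplicity $1$; weight $(p-1)p^{2m-2}$ with multiplicity $(p^m-1)(p^{m-1}+1)$; weight $(p-1)p^{2m-2}\left(1+\frac{1}{p^{m-1}}\right)$ with multiplicity $(p^m-1)p^{m-1}(p-1)$.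
   Context: An $[n,k]$ linear code over $\mathbb{F}_p$ is a $k$-dimensional subspace of $\mathbb{F}_p^n$. The multiplicity of a weight $w$ is the number of codewords of Hamming weight $w$; a code is $t$-weight if exactly $t$ nonzero weights occur.
   Formalization: The case m = 1 with p ≡ 3 (mod 4) (so v = 1) is excluded: there D_2 is empty, since x²+y²=0 has only the zero solution in F_p, so the code is zero and cannot have dimension 2m = 2. *)

(* Defs.v *)
From HB Require Import structures.
From mathcomp Require Import all_boot all_order all_algebra all_field.
Set Implicit Arguments. Unset Strict Implicit. Unset Printing Implicit Defensive.
Import GRing.Theory.
Local Open Scope ring_scope.

(* Absolute trace F_q -> F_p, q = p^m, valued in F (its values lie in the
   prime subfield {x | x^p = x}). *)
Definition tr (F : finFieldType) (p m : nat) (x : F) : F :=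
  \sum_(i < m) x ^+ (p ^ i).

Definition D2 (F : finFieldType) (p m u : nat) : {set F * F} :=
  [set xy : F * F | (xy != (0, 0)) &&
     (tr p m (xy.1 ^+ 2 + xy.2 ^+ (p ^ u + 1)) == 0)].

Definition cw (F : finFieldType) (p m u : nat) (a b : F) : seq F :=
  [seq tr p m (a * xy.1 + b * xy.2) | xy <- enum (D2 F p m u)].

Definition code (F : finFieldType) (p m u : nat) : seq (seq F) :=
  undup [seq cw p m u ab.1 ab.2 | ab <- enum [set: F * F]].

Definition wt (F : finFieldType) (c : seq F) : nat := count (fun x => x != 0) c.

Definition addw (F : finFieldType) (c d : seq F) : seq F :=
  [seq z.1 + z.2 | z <- zip c d].

(* Main.v *)
(* With q = p^m, the function Q(x, y) = Tr(x^2 + y^(p^u + 1)) is a nondegenerate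
   quadratic form on the 2m-dimensional F_p-space F_q^2, and every codeword is
   the restriction of z |-> B(w, z) to the zeros of Q, B being the polar form.

   Weights: counting the pairs (s, z) with Q(z) + s B(w, z) = 0, first by s
   (where Q(z) + s B(w, z) = Q(z + s w) - s^2 Q(w)) and then by z, expresses
   #{Q = 0, B(w, .) = 0} through the sizes N(c) of the level sets of Q.

   Level sets: similitudes of Q make N(c) = N independent of c != 0, and the
   sum of N(c)^2 counts pairs with Q(z) = Q(z'), which yields
   (p N - q^2)^2 = q^2.  The sign in p N = q^2 +- q is read off a congruence
   for N given by a group acting freely on a level set:
   - if m/v is odd, y^(p^u + 1) may be replaced by y^2, and the rotation
     (x, y) |-> (-y, x) gives 4 | N;
   - if m = 2k with k/v odd, the (p^v + 1)-st roots of unity act on y.  When -1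
     is a square in F_(p^k), Tr(x^2) is isometric to Tr(x^(p^k + 1)), on which
     they act too, so p^v + 1 divides N.  Otherwise Tr(x^2) has a totally
     isotropic subspace of size p^k, which gives its level sets exactly, and N
     is congruent to #{x | Tr(x^2) = 1} modulo p^v + 1. *)
Require Import Defs.
From HB Require Import structures.
From mathcomp Require Import all_boot all_order all_fingroup all_algebra all_solvable all_field.
From mathcomp Require Import ring zify.
Set Implicit Arguments. Unset Strict Implicit. Unset Printing Implicit Defensive.
Import GRing.Theory.
Local Open Scope ring_scope.

(* Makes the product of two finite fields a [finZmodType]. *)
HB.saturate prod.

(** * Sizes of level sets *)

Definition level (V : finType) (T : eqType) (f : V -> T) (c : T) : nat :=
  #|[set z | f z == c]|.

Lemma card_sum_nat (V : finType) (P : pred V) :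
  #|[set z | P z]| = (\sum_z P z)%N.
Proof.
by rewrite -sum1_card big_mkcond /=; apply: eq_bigr => z _; rewrite inE; case: (P z).
Qed.

Lemma sum_level (V T : finType) (f : V -> T) (A : {set T}) :
  (forall z, f z \in A) -> (\sum_(c in A) level f c)%N = #|V|.
Proof.
move=> fA; rewrite -(sum1_card V) (partition_big f (mem A)) //=.
by apply: eq_bigr => c _; rewrite /level -sum1_card; apply: eq_bigl => z; rewrite inE.
Qed.

Lemma level_bij (V W : finType) (T : eqType) (f : V -> T) (g : W -> T) (h : V -> W)
    c d :
  bijective h -> (forall z, (g (h z) == d) = (f z == c)) -> level g d = level f c.
Proof.
move=> bh E; rewrite /level -(card_imset (mem [set z | f z == c]) (bij_inj bh)).
case: bh => k hk kh; apply: eq_card => w; rewrite !inE.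
apply/idP/imsetP => [gw|[z]]; last by rewrite !inE => fz ->; rewrite E.
by exists (k w); rewrite ?kh // inE -E kh.
Qed.

(** * The prime subfield and additive maps into it *)

Section PrimeSubfield.

Variables (F : finFieldType) (p : nat).
Hypothesis hchar : p \in [pchar F].

Definition prime_subfield : {set F} := [set x | x ^+ p == x].

Lemma natr_prime_subfield n : n%:R \in prime_subfield.
Proof. by rewrite inE -(pFrobenius_autE hchar) pFrobenius_aut_nat. Qed.

Lemma natr_inj_pchar : {in gtn p &, injective (fun n => n%:R : F)}.
Proof.
move=> i j; rewrite !inE => ip jp.
wlog le_ij : i j ip jp / (i <= j)%N.
  move=> wl eij; case/orP: (leq_total i j) => h; first exact: wl.
  by apply/esym/wl.
move/eqP; rewrite eq_sym -subr_eq0 -natrB // -(dvdn_pcharf hchar) => dv.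
apply/eqP; rewrite eqn_leq le_ij -subn_eq0 /=.
by case: posnP => // /dvdn_leq /(_ dv); lia.
Qed.

(** The [p] multiples of 1 are fixed by Frobenius, and ['X^p - 'X] has at most [p] roots. *)
Lemma prime_subfieldE :
  prime_subfield = [set (i : nat)%:R | i : 'I_p].
Proof.
apply/esym/eqP; rewrite eqEcard; apply/andP; split.
  by apply/subsetP => _ /imsetP [i _ ->]; apply: natr_prime_subfield.
rewrite card_imset; last first.
  move=> i j /= E; apply: val_inj.
  by apply: natr_inj_pchar; rewrite ?inE ?ltn_ord.
rewrite card_ord cardE.
have sz : size ('X^p - 'X : {poly F}) = p.+1.
  rewrite size_polyDl size_polyXn // size_polyN size_polyX ltnS.
  exact/prime_gt1/(pcharf_prime hchar).
rewrite -ltnS -sz; apply: max_poly_roots; last exact: enum_uniq.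
  by rewrite -size_poly_eq0 sz.
by apply/allP => x; rewrite mem_enum inE rootE !hornerE subr_eq0.
Qed.

Lemma prime_subfieldP x :
  reflect (exists2 n, (n < p)%N & x = n%:R) (x \in prime_subfield).
Proof.
apply: (iffP idP) => [|[n _ ->]]; last exact: natr_prime_subfield.
by rewrite prime_subfieldE => /imsetP [i _ ->]; exists (i : nat).
Qed.

Lemma card_prime_subfield : #|prime_subfield| = p.
Proof.
rewrite prime_subfieldE card_imset ?card_ord // => i j /= E; apply: val_inj.
by apply: natr_inj_pchar; rewrite ?inE ?ltn_ord.
Qed.

Lemma prime_subfieldM x y :
  x \in prime_subfield -> y \in prime_subfield -> x * y \in prime_subfield.
Proof. by rewrite !inE exprMn => /eqP -> /eqP ->. Qed.

Lemma prime_subfieldV x : x \in prime_subfield -> x^-1 \in prime_subfield.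
Proof. by rewrite !inE exprVn => /eqP ->. Qed.

Lemma prime_subfieldD x y :
  x \in prime_subfield -> y \in prime_subfield -> x + y \in prime_subfield.
Proof.
by move=> /prime_subfieldP[i _ ->] /prime_subfieldP[j _ ->]; rewrite -natrD natr_prime_subfield.
Qed.

Lemma prime_subfieldN x : x \in prime_subfield -> - x \in prime_subfield.
Proof. by rewrite !inE -!(pFrobenius_autE hchar) pFrobenius_autN => /eqP ->. Qed.

Lemma sum_prime_subfield_neq0 N :
  (\sum_(c in prime_subfield | c != 0%R) N = (p - 1) * N)%N.
Proof.
rewrite sum_nat_const; congr muln.
rewrite -card_prime_subfield (cardsD1 0 prime_subfield).
rewrite (natr_prime_subfield 0) add1n subn1 /=.
by apply: eq_card => c; rewrite [LHS]unfold_in !inE andbC.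
Qed.

Section AdditiveFibres.

Variables (V : finZmodType) (f : V -> F).
Hypotheses (fD : {morph f : x y / x + y}) (fFp : forall z, f z \in prime_subfield).

(** Some multiple of [z0] is sent to any prescribed element of the prime field; translation by it
    carries the fibre over 0 onto the fibre over that element. *)
Lemma level_additive z0 c :
  f z0 != 0 -> c \in prime_subfield -> (p * level f c)%N = #|V|.
Proof.
move=> nz0 cFp.
have f0 : f 0 = 0 by apply: (addrI (f 0)); rewrite -fD !addr0.
have fMn z n : f (z *+ n) = f z * n%:R.
  by elim: n => [|n IH]; rewrite ?mulr0n ?mulr0 // mulrSr fD IH -natr1 mulrDr mulr1.
have lvl d : d \in prime_subfield -> level f d = level f 0.
  move=> dFp; have : d / f z0 \in prime_subfield.
    by rewrite prime_subfieldM // prime_subfieldV.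
  move=> /prime_subfieldP [n _ E].
  apply: (level_bij (h := fun z => z + z0 *+ n)).
    by exists (fun z => z - z0 *+ n) => z; rewrite ?addrK ?subrK.
  move=> z; rewrite fD fMn -E mulrC divfK // -subr_eq0 addrK //.
rewrite -(sum_level fFp) (eq_bigr (fun=> level f 0)) => [|d dFp]; last exact: lvl.
by rewrite sum_nat_const card_prime_subfield lvl.
Qed.

End AdditiveFibres.

(** * Level sets of a quadratic form over the prime field *)

Section QuadraticForm.

Variables (V : finZmodType) (Q : V -> F).

(** The factor 1/2 is left out, so that [polar w w] is [2 * Q w]. Scalars of the prime field act as
    integer multiples, hence additivity of [polar w] amounts to linearity. *)
Definition polar (w z : V) : F := Q (z + w) - Q z - Q w.

Hypotheses (Qeven : forall z, Q (- z) = Q z) (QFp : forall z, Q z \in prime_subfield).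
Hypothesis polarD : forall w, {morph polar w : x y / x + y}.
Hypothesis nondegenerate : forall w : V, w != 0 -> exists z, polar w z != 0.

Lemma polarC w z : polar w z = polar z w.
Proof. by rewrite /polar (addrC z w); ring. Qed.

Lemma polar_prime_subfield w z : polar w z \in prime_subfield.
Proof. by rewrite !(prime_subfieldD, prime_subfieldN) ?QFp. Qed.

Lemma polarMn w z n : polar w (z *+ n) = n%:R * polar w z.
Proof.
have f0 : polar w 0 = 0 by apply: (addrI (polar w 0)); rewrite -polarD !addr0.
by elim: n => [|n IH]; rewrite ?mulr0n ?mul0r // mulrSr polarD IH -natr1; ring.
Qed.

Lemma form0 : Q 0 = 0.
Proof.
have := polarMn 0 0 0; rewrite mulr0n mul0r /polar addr0 => /eqP.
by rewrite subrr sub0r oppr_eq0 => /eqP.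
Qed.

Lemma polar_diag w : polar w w = 2%:R * Q w.
Proof.
have f0 : polar w 0 = 0 by rewrite -(mulr0n 0) polarMn mul0r.
have : polar w (- w) = - polar w w by apply/eqP; rewrite -addr_eq0 -polarD addNr f0.
by rewrite {1}/polar addNr form0 Qeven => E; rewrite -[LHS]opprK -E; ring.
Qed.

Lemma formD z w : Q (z + w) = Q z + Q w + polar w z.
Proof. by rewrite /polar; ring. Qed.

Lemma formMn w n : Q (w *+ n) = (n ^ 2)%:R * Q w.
Proof.
elim: n => [|n IH]; first by rewrite mulr0n form0 mul0r.
by rewrite mulrSr formD IH polarMn polar_diag -!mulnn -natr1 !natrM -natr1; ring.
Qed.

Lemma level_polar w c :
  w != 0 -> c \in prime_subfield -> (p * level (polar w) c)%N = #|V|.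
Proof.
move=> /nondegenerate [z nz] cFp.
by have := level_additive (polarD w) (polar_prime_subfield w) nz cFp.
Qed.

(** Count the pairs [(z, z + w)] with equal values: for fixed [w] the condition is
    [polar w z = - Q w], which holds for all [z] if [w = 0] and for [#|V| / p] of them otherwise. *)
Lemma sum_level_sqr :
  (p * \sum_(c in prime_subfield) level Q c * level Q c = p * #|V| + (#|V| - 1) * #|V|)%N.
Proof.
have -> : (\sum_(c in prime_subfield) level Q c * level Q c = \sum_z level Q (Q z))%N.
  rewrite (partition_big Q (mem prime_subfield)) //=; apply: eq_bigr => c _.
  rewrite (eq_bigr (fun=> level Q c)) => [|z /eqP -> //].
  by rewrite sum_nat_const /level cardsE.
have -> : (\sum_z level Q (Q z) = \sum_w level (polar w) (- Q w))%N.
  transitivity (\sum_(z : V) \sum_(w : V) (polar w z == - Q w))%N.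
    apply: eq_bigr => z _; rewrite /level card_sum_nat.
    rewrite (reindex_inj (addrI z)); apply: eq_bigr => w _ /=.
    by congr nat_of_bool; rewrite formD -subr_eq0 -[RHS]subr_eq0; congr (_ == _); ring.
  by rewrite exchange_big /=; apply: eq_bigr => w _; rewrite /level card_sum_nat.
rewrite (bigD1 0) //= mulnDr; congr (_ * _ + _)%N.
  rewrite /level form0 oppr0 -[RHS]cardsT; apply: eq_card => z.
  by rewrite !inE /polar addr0 form0 subr0 subrr eqxx.
rewrite big_distrr /= (eq_bigr (fun=> #|V|)) => [|w nz].
  by rewrite sum_nat_const cardC1 subn1.
by rewrite level_polar ?prime_subfieldN ?QFp.
Qed.

Variable N : nat.
Hypothesis levelN : forall c, c \in prime_subfield -> c != 0 -> level Q c = N.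

Lemma level0_levelN : (level Q 0%R + (p - 1) * N = #|V|)%N.
Proof.
have Fp0 : 0 \in prime_subfield by rewrite -[0]/(0%:R) natr_prime_subfield.
rewrite -(sum_level QFp) (bigD1 0) //=; congr addn.
rewrite (eq_bigr (fun=> N)) => [|c /andP [cFp nz]]; last exact: levelN.
exact/esym/sum_prime_subfield_neq0.
Qed.

Lemma levelN_quadratic : ((p * N)%:Z - #|V|%:Z) ^+ 2 = #|V|%:Z.
Proof.
have Fp0 : 0 \in prime_subfield by rewrite -[0]/(0%:R) natr_prime_subfield.
have E1 := level0_levelN; have := sum_level_sqr.
rewrite (bigD1 0) //= (eq_bigr (fun=> (N * N)%N)); last first.
  by move=> c /andP [cFp nz]; rewrite levelN.
rewrite sum_prime_subfield_neq0.
move=> E2; have p1 := prime_gt1 (pcharf_prime hchar).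
have X0 : (0 < #|V|)%N by apply/card_gt0P; exists 0.
apply/eqP; rewrite -subr_eq0; apply/eqP.
(* Eliminating [level Q 0] between the sum of the level sizes and the sum of their squares leaves
   [p - 1] times the desired identity. *)
apply: (@mulfI _ (p%:Z - 1)); first by lia.
move: (#|V|) (level Q 0) E1 E2 X0 => X N0 E1 E2 X0; rewrite mulr0.
have {}E1 : N0%:Z = X%:Z - (p%:Z - 1) * N%:Z by nia.
have {}E2 : p%:Z * (N0%:Z * N0%:Z + (p%:Z - 1) * (N%:Z * N%:Z)) = p%:Z * X%:Z + (X%:Z - 1) * X%:Z.
  by nia.
rewrite PoszM; move: E2; rewrite E1 => /eqP; rewrite -subr_eq0 => /eqP E2.
by rewrite -[RHS]E2; ring.
Qed.

Lemma levels_along_line w :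
  (p * #|[set z | (Q z == 0%R) && (polar w z == 0%R)]| + #|[set z | polar w z != 0%R]|
   = \sum_(s < p) level Q ((s ^ 2)%N%:R * Q w)%R)%N.
Proof.
have p1 := prime_gt1 (pcharf_prime hchar).
have -> : (\sum_(s < p) level Q ((s ^ 2)%N%:R * Q w)%R =
           \sum_(s < p) \sum_(z : V) ((Q z + s%:R * polar w z)%R == 0%R))%N.
  apply: eq_bigr => s _; rewrite /level card_sum_nat (reindex_inj (addIr (w *+ s))).
  apply: eq_bigr => z _ /=; congr nat_of_bool.
  by rewrite formD formMn polarC polarMn polarC -subr_eq0; congr (_ == _); ring.
rewrite exchange_big !card_sum_nat big_distrr /= -big_split /=.
(* For fixed [z] the equation is affine in [s]: it has [p] solutions or none if [polar w z = 0], and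
   exactly one otherwise. *)
apply: eq_bigr => z _; case: (eqVneq (polar w z) 0) => [->|nz].
  rewrite andbT addn0 (eq_bigr (fun=> (Q z == 0 : nat))) => [|s _].
    by rewrite sum_nat_const card_ord.
  by rewrite mulr0 addr0.
rewrite andbF muln0 add0n.
have : - Q z / polar w z \in prime_subfield.
  by rewrite prime_subfieldM ?prime_subfieldN ?prime_subfieldV ?polar_prime_subfield.
case/prime_subfieldP => s0 ls0 E.
rewrite (bigD1 (Ordinal ls0)) //= -E divfK // addrN eqxx big1 //= => s ns.
apply/eqP; rewrite eqb0; apply: contra ns => Es; apply/eqP/val_inj => /=.
apply: natr_inj_pchar; rewrite ?inE //.
by rewrite -E -(addrK (s%:R * polar w z) (- Q z)) addrAC -opprD (eqP Es) oppr0 add0r mulfK.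
Qed.

Lemma card_polar_neq0 w :
  w != 0 -> (p * #|[set z | polar w z != 0%R]| = (p - 1) * #|V|)%N.
Proof.
move=> nz; have Fp0 : 0 \in prime_subfield by rewrite -[0]/(0%:R) natr_prime_subfield.
have C : (level (polar w) 0%R + #|[set z | polar w z != 0%R]| = #|V|)%N.
  rewrite /level -[RHS](cardsC [set z | polar w z == 0]); congr addn.
  by apply: eq_card => z; rewrite !inE.
by have := congr1 (muln p) C; rewrite mulnDr (level_polar nz Fp0) mulnBl; lia.
Qed.

Lemma card_zeros_split w :
  (#|[set z | (Q z == 0%R) && (polar w z == 0%R)]|
   + #|[set z | (Q z == 0%R) && (polar w z != 0%R)]| = level Q 0%R)%N.
Proof.
rewrite /level -(cardsID [set z | polar w z == 0] [set z | Q z == 0]).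
by congr addn; apply: eq_card => z; rewrite !inE // andbC.
Qed.

(** On the line through an isotropic [w] every term is [level Q 0], which cancels; the result does
    not involve [N]. *)
Lemma weight_isotropic w : w != 0 -> Q w = 0 ->
  (p ^ 2 * #|[set z | (Q z == 0%R) && (polar w z != 0%R)]| = (p - 1) * #|V|)%N.
Proof.
move=> nz Qw0; have := levels_along_line w; have := card_polar_neq0 nz.
rewrite (eq_bigr (fun=> level Q 0)) => [|s _]; last by rewrite Qw0 mulr0.
rewrite sum_nat_const card_ord; have := card_zeros_split w; nia.
Qed.

(** The term [s = 0] gives [level Q 0] and the other [p - 1] terms give [N], so the sum along the
    line is [#|V|]. *)
Lemma weight_anisotropic w : Q w != 0 ->
  (p ^ 2 * #|[set z | (Q z == 0%R) && (polar w z != 0%R)]| + #|V| = p ^ 2 * level Q 0%R)%N.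
Proof.
move=> Qw0; have nz : w != 0 by apply: contraNneq Qw0 => ->; rewrite form0.
have := levels_along_line w; have := card_polar_neq0 nz.
have -> : (\sum_(s < p) level Q ((s ^ 2)%N%:R * Q w)%R = #|V|)%N.
  have p0 := prime_gt0 (pcharf_prime hchar).
  rewrite (bigD1 (Ordinal p0)) //= mul0r -level0_levelN; congr addn.
  rewrite (eq_bigr (fun=> N)) => [|s ns]; last first.
    rewrite levelN ?prime_subfieldM ?natr_prime_subfield ?QFp // mulf_neq0 //.
    rewrite natrX expf_neq0 // -(dvdn_pcharf hchar) gtnNdvd ?ltn_ord //.
    by rewrite lt0n; apply: contra ns => /eqP E; apply/eqP/val_inj.
  by rewrite sum_nat_const cardC1 card_ord subn1.
have := card_zeros_split w; have := prime_gt1 (pcharf_prime hchar); nia.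
Qed.

End QuadraticForm.

End PrimeSubfield.

(** * Powers in finite fields *)

(** Every orbit of [f] in [A] has exactly [d] elements. *)
Lemma dvdn_free_iter (V : finType) (f : V -> V) (A : {set V}) d :
  injective f -> (forall z, (f z \in A) = (z \in A)) -> (0 < d)%N ->
  (forall z, z \in A -> iter d f z = z) ->
  (forall z i, z \in A -> (0 < i < d)%N -> iter i f z != z) -> (d %| #|A|)%N.
Proof.
move=> fI fA d0 fd fN; rewrite -(@fcard_order_set _ f fI d (mem A)).
- exact: dvdn_mull.
- apply/subsetP => z zA; rewrite inE.
  have o0 : (0 < fingraph.order f z)%N by rewrite -fingraph.orderSpred.
  have le_d : (fingraph.order f z <= d)%N.
    rewrite leqNgt; apply/negP => lt_d.
    have := findex_iter lt_d; rewrite fd // findex0 => E.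
    by rewrite -E in d0.
  rewrite eqn_leq le_d leqNgt; apply/negP => lt_d.
  by have := fN z (fingraph.order f z) zA; rewrite o0 lt_d iter_order // eqxx => /(_ isT).
- by move=> x y /eqP <-; apply/esym/fA.
Qed.

Lemma odd_dvdn_expS a n : odd n -> (a.+1 %| (a ^ n).+1)%N.
Proof.
move=> on; rewrite -(odd_double_half n) on add1n; move: (n./2) => {on}k.
elim: k => [|k IH]; first by rewrite expn1.
case: a IH => [|a] IH; first by rewrite exp0n.
(* With [b = a.+1], this is [b^(2k+3) + 1 + (b + 1)(b - 1) = b^2 (b^(2k+1) + 1)], written without
   subtraction. *)
have E : ((a.+1 ^ k.+1.*2.+1).+1 + a.+2 * a = a.+1 * a.+1 * (a.+1 ^ k.*2.+1).+1)%N.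
  by rewrite doubleS !(expnS _ _.+1); lia.
have : (a.+2 %| (a.+1 ^ k.+1.*2.+1).+1 + a.+2 * a)%N by rewrite E dvdn_mull.
by rewrite dvdn_addl ?dvdn_mulr.
Qed.

Section FiniteFieldPowers.

Variable F : finFieldType.

Lemma finField_prim_root : exists g : F, (#|F|.-1).-primitive_root g.
Proof.
have q1 : (0 < #|F|.-1)%N by have := finNzRing_gt1 F; case: #|F| => [|[]].
have : has (#|F|.-1).-primitive_root [seq x <- enum F | x != 0].
  apply: has_prim_root => //.
  - apply/allP => x; rewrite mem_filter unity_rootE => /andP [nx _].
    by rewrite -(inj_eq (mulfI nx)) -exprS prednK ?expf_card ?mulr1 // ltnW // finNzRing_gt1.
  - by rewrite filter_uniq ?enum_uniq.
  - rewrite -(cardC1 (0 : F)) cardE {1}/enum_mem -enumT.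
    by rewrite eq_leq //; congr size; apply: eq_filter => x; rewrite !inE.
by case/hasP => g _; exists g.
Qed.

Lemma expf_card_pred (c : F) : c != 0 -> c ^+ #|F|.-1 = 1.
Proof.
move=> nc; apply: (mulfI nc).
by rewrite -exprS prednK ?expf_card ?mulr1 // ltnW // finNzRing_gt1.
Qed.

(** Writing [c] as a power [g ^+ i] of a generator, the hypothesis forces [d] to divide [i]. *)
Lemma power_residue d (c : F) : (d %| #|F|.-1)%N -> c != 0 ->
  c ^+ (#|F|.-1 %/ d) = 1 -> exists x : F, x ^+ d = c.
Proof.
move=> dq nc E; have [g gP] := finField_prim_root.
have [i Ei] := prim_rootP gP (expf_card_pred nc).
have d0 : (0 < d)%N by apply: dvdn_gt0 dq; apply: prim_order_gt0 gP.
have : (d %| i)%N.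
  move: E; rewrite Ei -exprM => /eqP; rewrite -(prim_order_dvd gP).
  rewrite -{1}(divnK dq) mulnC dvdn_pmul2r // divn_gt0 // dvdn_leq //.
  exact: prim_order_gt0 gP.
by rewrite Ei; case/dvdnP => j ->; exists (g ^+ j); rewrite exprM.
Qed.

Lemma prim_root_dvd_card d :
  (d %| #|F|.-1)%N -> exists z : F, d.-primitive_root z.
Proof.
move=> dq; have [g gP] := finField_prim_root.
by exists (g ^+ (#|F|.-1 %/ d)); apply: dvdn_prim_root.
Qed.

(** Each nonzero square has at most two roots, so the set [S] of squares fills more than half of [F]
    and must meet [c - S]. *)
Lemma sum_two_squares (c : F) : exists ab : F * F, ab.1 ^+ 2 + ab.2 ^+ 2 = c.
Proof.
pose S := [set x ^+ 2 | x : F].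
have cS : (#|F| < #|S| + #|S|)%N.
  have S0 : 0 \in S by apply/imsetP; exists 0; rewrite ?expr0n.
  have -> : #|F| = (\sum_(s in S) #|[set x : F | x ^+ 2 == s]|)%N.
    by rewrite (@sum_level F F (fun x => x ^+ 2)) // => z; apply: imset_f.
  rewrite (bigD1 0) //=.
  have -> : [set x : F | x ^+ 2 == 0] = [set 0].
    by apply/setP => x; rewrite !inE sqrf_eq0.
  rewrite cards1 add1n (cardsD1 0 S) S0 !add1n.
  have : (\sum_(s in S | s != 0%R) #|[set x : F | x ^+ 2 == s]|
          <= \sum_(s in S :\ 0%R) 2)%N.
    rewrite (eq_bigl (fun s => s \in S :\ 0)) => [|s]; last by rewrite !inE andbC.
    apply: leq_sum => _ /setD1P [_ /imsetP [x _ ->]].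
    apply: (@leq_trans #|[set x; - x]|); last by rewrite cards2; case: (_ != _).
    by apply: subset_leq_card; apply/subsetP => y; rewrite !inE eqf_sqr.
  rewrite sum_nat_const; move: (\sum_(i in S | _) _)%N => n.
  by move: (#|S :\ 0|) => k; lia.
have cT : #|[set c - s | s in S]| = #|S|.
  by apply: card_imset => x y /addrI /oppr_inj.
have : (0 < #|S :&: [set (c - s)%R | s in S]|)%N.
  rewrite lt0n; apply/eqP => I0.
  have := cardsUI S [set c - s | s in S]; rewrite I0 addn0 cT => U.
  by have := max_card (mem (S :|: [set c - s | s in S])); rewrite U leqNgt cS.
case/card_gt0P => x /setIP [/imsetP [a _ ->]] /imsetP [_ /imsetP [b _ ->] E].
by exists (a, b); rewrite /= E subrK.
Qed.

End FiniteFieldPowers.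

(** * The trace form *)

Section Trace.

Variables (F : finFieldType) (p m : nat).
Hypotheses (hchar : p \in [pchar F]) (hm : (0 < m)%N) (hcard : #|F| = (p ^ m)%N).

Lemma exprDp k (x y : F) : (x + y) ^+ (p ^ k) = x ^+ (p ^ k) + y ^+ (p ^ k).
Proof.
rewrite exprDn_pchar // pnatX; apply/orP; left.
by rewrite pnatE ?(pcharf_prime hchar).
Qed.

Lemma exprNp k (x : F) : (- x) ^+ (p ^ k) = - x ^+ (p ^ k).
Proof.
apply/eqP; rewrite -addr_eq0 -exprDp addNr expr0n expn_eq0.
by have := prime_gt0 (pcharf_prime hchar); case: p.
Qed.

Lemma expr_prime_subfield k x : x \in prime_subfield F p -> x ^+ (p ^ k) = x.
Proof.
rewrite inE => /eqP E; elim: k => [|k IH]; first by rewrite expr1.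
by rewrite expnS exprM E.
Qed.

Lemma exprp_card (x : F) k : x ^+ (p ^ (k * m)) = x.
Proof.
elim: k => [|k IH]; first by rewrite expr1.
by rewrite mulSn expnD exprM -hcard expf_card.
Qed.

Lemma tr_add : {morph (tr p m : F -> F) : x y / x + y}.
Proof.
by move=> x y; rewrite /tr -big_split; apply: eq_bigr => i _; rewrite exprDp.
Qed.

Lemma tr0 : tr p m (0 : F) = 0.
Proof. by apply: (addrI (tr p m (0 : F))); rewrite -tr_add !addr0. Qed.

Lemma trN (x : F) : tr p m (- x) = - tr p m x.
Proof. by rewrite /tr -sumrN; apply: eq_bigr => i _; rewrite exprNp. Qed.

Lemma trZ c (x : F) : c \in prime_subfield F p -> tr p m (c * x) = c * tr p m x.
Proof.
move=> cFp; rewrite /tr big_distrr /=; apply: eq_bigr => i _.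
by rewrite exprMn expr_prime_subfield.
Qed.

(** Frobenius permutes the [m] summands of the trace cyclically. *)
Lemma tr_exprp (x : F) k : tr p m (x ^+ (p ^ k)) = tr p m x.
Proof.
elim: k => [|k <-]; first by rewrite expr1.
rewrite expnSr exprM; move: (x ^+ _) => y; rewrite /tr.
case: m hm hcard (exprp_card y 1) => // n _ _; rewrite mul1n => E.
rewrite big_ord_recr big_ord_recl /= -exprM -expnS E addrC expr1; congr (_ + _).
by apply: eq_bigr => i _; rewrite -exprM -expnS.
Qed.

Lemma tr_prime_subfield (x : F) : tr p m x \in prime_subfield F p.
Proof.
rewrite inE -[X in _ == X](tr_exprp x 1) expn1 /tr.
rewrite -!(pFrobenius_autE hchar) rmorph_sum /=; apply/eqP.
by apply: eq_bigr => i _; rewrite -rmorphXn.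
Qed.

(** As a polynomial the trace has degree [p ^ m.-1], which is less than [#|F|]. *)
Lemma tr_neq0 : exists x : F, tr p m x != 0.
Proof.
case: (pickP (fun x : F => tr p m x != 0)) => [x nx|trz]; first by exists x.
pose P : {poly F} := \sum_(i < m) 'X^(p ^ i).
have p1 := prime_gt1 (pcharf_prime hchar).
have sP : size P = (p ^ m.-1).+1.
  rewrite /P; case: m hm => // n _; rewrite big_ord_recr /= addrC.
  rewrite size_polyDl size_polyXn // ltnS.
  apply: (leq_trans (size_sum _ _ _)); apply/bigmax_leqP => i _.
  by rewrite size_polyXn ltn_exp2l.
have : (size (enum F) < size P)%N.
  apply: max_poly_roots; rewrite ?enum_uniq -?size_poly_eq0 ?sP //.
  apply/allP => x _; have /negbFE/eqP := trz x; rewrite /root /tr => <-.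
  rewrite horner_sum; apply/eqP; apply: eq_bigr => i _.
  by rewrite hornerXn.
by rewrite -cardE hcard sP ltnS leqNgt ltn_exp2l // prednK ?leqnn // ltn_predL hm.
Qed.

Lemma tr_nondegenerate (a : F) : a != 0 -> exists x, tr p m (a * x) != 0.
Proof.
by move=> nz; case: tr_neq0 => x nx; exists (a^-1 * x); rewrite mulVKf.
Qed.

(** Raising the argument to the power [p ^ k] keeps its trace and undoes the power [p ^ j]; the two
    powers are adjoint for the trace pairing. *)
Lemma tr_mul_exprp (x y : F) j k : (m %| j + k)%N ->
  tr p m (x * y ^+ (p ^ j)) = tr p m (x ^+ (p ^ k) * y).
Proof.
case/dvdnP => n E; rewrite -(tr_exprp _ k) exprMn -exprM -expnD E.
by rewrite exprp_card.
Qed.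

(** * The quadratic form [Tr(x^2 + y^(p^u + 1))] and its polar form *)

Variable u : nat.
Hypotheses (hodd : odd p)
  (hmv : odd (m %/ gcdn m u) || ((m %/ gcdn m u) %% 4 == 2)%N).

Definition traceform (z : F * F) : F := tr p m (z.1 ^+ 2 + z.2 ^+ (p ^ u + 1)).

(** The vector representing [polar traceform w] in the trace pairing. The power [p ^ (m.-1 * u)]
    inverts the power [p ^ u], since [u + m.-1 * u] is a multiple of [m]. *)
Definition polar_dual (w : F * F) : F * F :=
  (2%:R * w.1, w.2 ^+ (p ^ u) + w.2 ^+ (p ^ (m.-1 * u))).

Lemma natr2_neq0 : 2%:R != 0 :> F.
Proof.
rewrite -(dvdn_pcharf hchar) dvdn_prime2 ?(pcharf_prime hchar) //.
by apply: contraL hodd => /eqP ->.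
Qed.

Lemma traceform_even z : traceform (- z) = traceform z.
Proof. by rewrite /traceform /= !addn1 !(exprS _ (p ^ u)) exprNp; congr (tr p m _); ring. Qed.

Lemma traceform_prime_subfield z : traceform z \in prime_subfield F p.
Proof. exact: tr_prime_subfield. Qed.

Lemma polar_traceform w z :
  polar traceform w z = tr p m ((polar_dual w).1 * z.1 + (polar_dual w).2 * z.2).
Proof.
rewrite /polar /traceform /= !addn1 !(exprSr _ (p ^ u)) exprDp.
have -> : tr p m (2 * w.1 * z.1 + (w.2 ^+ (p ^ u) + w.2 ^+ (p ^ (m.-1 * u))) * z.2)
   = tr p m (2 * w.1 * z.1 + w.2 ^+ (p ^ u) * z.2 + w.2 * z.2 ^+ (p ^ u)).
  have E : (m %| u + m.-1 * u)%N by rewrite -mulSn prednK // dvdn_mulr.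
  by rewrite [(_ + _) * z.2]mulrDl !tr_add (tr_mul_exprp _ _ E) addrA.
rewrite -!trN -!tr_add; congr (tr p m _); ring.
Qed.

Lemma polar_traceformD w : {morph polar traceform w : x y / x + y}.
Proof.
move=> x y; rewrite !polar_traceform -tr_add; congr (tr p m _) => /=; ring.
Qed.

Lemma polar_dualD : {morph polar_dual : x y / x + y}.
Proof.
by move=> x y; rewrite /polar_dual /= !exprDp; congr (_, _); rewrite /=; ring.
Qed.

(** An odd number [N] of iterations of [y |-> y ^+ (p ^ (2 * u))] is then the identity, which rules
    out a nonzero [y] sent to [- y]. This is how the hypothesis on [m / v] yields nondegeneracy. *)
Lemma odd_multiple : exists2 N, odd N & (m %| 2 * u * N)%N.
Proof.
have v0 : (0 < gcdn m u)%N by rewrite gcdn_gt0 hm.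
have Em := divnK (dvdn_gcdl m u); have Eu := divnK (dvdn_gcdr m u).
case/orP: hmv => [o|/eqP E].
  exists (m %/ gcdn m u)%N => //; apply/dvdnP; exists (2 * (u %/ gcdn m u))%N; nia.
(* [N = m / (2v)] is odd because [m / v] is 2 modulo 4, and [2 u N = m (u / v)]. *)
exists (m %/ gcdn m u %/ 2)%N; first by lia.
apply/dvdnP; exists (u %/ gcdn m u)%N.
have : (m %/ gcdn m u = 2 * (m %/ gcdn m u %/ 2))%N by lia.
move: (_ %/ 2)%N => h; nia.
Qed.

Lemma exprp_double_opp (y : F) : y ^+ (p ^ (2 * u)) = - y -> y = 0.
Proof.
move=> E; have [N oN dN] := odd_multiple.
have EN n : y ^+ (p ^ (2 * u * n)) = (-1) ^+ n * y.
  elim: n => [|n IH]; first by rewrite muln0 !expr1 expr0 mul1r.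
  rewrite mulnS expnD exprM E exprNp IH exprS; ring.
have := EN N; case/dvdnP: dN => k ->; rewrite exprp_card -signr_odd oN expr1 mulN1r.
move/eqP; rewrite -addr_eq0 -mulr2n -mulr_natl mulf_eq0 (negPf natr2_neq0).
by move/eqP.
Qed.

Lemma polar_dual_eq0 w : polar_dual w = 0 -> w = 0.
Proof.
case: w => w1 w2 [] /eqP; rewrite mulf_eq0 (negPf natr2_neq0) /= => /eqP -> E.
congr (_, _); apply: exprp_double_opp.
(* The power [p ^ u] turns the equation for [w2] into [w2 ^+ (p ^ (2 * u)) + w2 = 0]. *)
have /(congr1 (fun x => x ^+ (p ^ u))) := E.
rewrite exprDp -!exprM -!expnD expr0n expn_eq0 addnn -mul2n -mulSnr prednK //.
rewrite (mulnC m) exprp_card eqn0Ngt (prime_gt0 (pcharf_prime hchar)) /=.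
by move/eqP; rewrite addr_eq0 => /eqP.
Qed.

Lemma polar_dual_inj : injective polar_dual.
Proof.
move=> x y E; apply/eqP; rewrite -subr_eq0; apply/eqP/polar_dual_eq0.
apply: (addIr (polar_dual y)); rewrite -polar_dualD subrK E.
by rewrite add0r.
Qed.

Lemma tr_pair_nondegenerate (ab : F * F) :
  ab != 0 -> exists z : F * F, tr p m (ab.1 * z.1 + ab.2 * z.2) != 0.
Proof.
case: ab => a b; rewrite -pair_eqE negb_and => /orP [] /tr_nondegenerate [x nx].
  by exists (x, 0); rewrite mulr0 addr0.
by exists (0, x); rewrite mulr0 add0r.
Qed.

Lemma traceform_nondegenerate (w : F * F) :
  w != 0 -> exists z, polar traceform w z != 0.
Proof.
move=> nz; have /tr_pair_nondegenerate [z nz2] : polar_dual w != 0.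
  by apply: contraNneq nz => /polar_dual_eq0 ->.
by exists z; rewrite polar_traceform.
Qed.

Lemma card_pred : #|F|.-1 = (p ^ m - 1)%N.
Proof. by rewrite hcard subn1. Qed.

Lemma odd_exp k : odd (p ^ k).
Proof. by rewrite oddX hodd orbT. Qed.

Lemma level_scale (V : finType) (f : V -> F) (c : F) (h : V -> V) :
  injective h -> c != 0 -> (forall z, f (h z) = c * f z) -> level f c = level f 1.
Proof.
move=> hI nc E; apply: (level_bij (h := h)); first exact: injF_bij.
by move=> z; rewrite E -{2}[c]mulr1 (inj_eq (mulfI nc)).
Qed.

(** * The case of odd [m / v] *)

Lemma coprime_half_orders : odd (m %/ gcdn m u) ->
  coprime ((p ^ u + 1) %/ 2) ((p ^ m - 1) %/ 2).
Proof.
move=> oN; rewrite /coprime; set r := gcdn _ _.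
have ou := odd_exp u; have om := odd_exp m.
have pm0 : (0 < p ^ m)%N by rewrite expn_gt0 (prime_gt0 (pcharf_prime hchar)).
have ru : (2 * r %| (p ^ u).+1)%N.
  have -> : ((p ^ u).+1 = 2 * ((p ^ u + 1) %/ 2))%N by lia.
  by rewrite dvdn_pmul2l // dvdn_gcdl.
have rm : (2 * r %| (p ^ m).-1)%N.
  have -> : ((p ^ m).-1 = 2 * ((p ^ m - 1) %/ 2))%N by lia.
  by rewrite dvdn_pmul2l // dvdn_gcdr.
(* [p ^ u] and [p ^ m] have this common power. As [m / v] is odd, [2 * r] divides the power plus 1;
   it also divides the power minus 1, hence it divides 2. *)
have E : ((p ^ u) ^ (m %/ gcdn m u) = (p ^ m) ^ (u %/ gcdn m u))%N.
  by rewrite -!expnM !muln_divA ?dvdn_gcdl ?dvdn_gcdr // mulnC.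
have d1 := dvdn_trans ru (odd_dvdn_expS (p ^ u) oN).
have d2 := dvdn_trans rm (dvdn_pred_predX (p ^ m) (u %/ gcdn m u)).
rewrite E in d1; move: d1 d2.
have : (0 < (p ^ m) ^ (u %/ gcdn m u))%N by rewrite expn_gt0 pm0.
case: ((p ^ m) ^ _)%N => // n _ d1; rewrite /= => d2.
have : (2 * r %| 2)%N by rewrite -(dvdn_addr 2 d2) addn2.
by rewrite -[X in (_ %| X)%N]muln1 dvdn_pmul2l // dvdn1.
Qed.

(* [t] is a power map [y ^+ s] with [s * (p ^ u + 1) = 2] modulo [p ^ m - 1]. *)
Lemma square_substitution : odd (m %/ gcdn m u) ->
  exists2 t : F -> F, injective t & forall y, t y ^+ (p ^ u + 1) = y ^+ 2.
Proof.
move/coprime_half_orders; have ou := odd_exp u; have om := odd_exp m.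
have : ((p ^ u + 1) %/ 2 * 2 = p ^ u + 1)%N by lia.
have : ((p ^ m - 1) %/ 2 * 2 = p ^ m - 1)%N by lia.
have : (0 < (p ^ u + 1) %/ 2)%N by lia.
move: ((p ^ u + 1) %/ 2)%N ((p ^ m - 1) %/ 2)%N => h M h0 EM Eh cop.
have [a0 b0 Eab _] := egcdnP M h0; rewrite (eqP cop) in Eab.
have [s [b [os Es]]] : exists s b, odd s /\ (s * h = b * M + 1)%N.
  case: (boolP (odd a0)) => o; first by exists a0, b0.
  (* An odd exponent is wanted so that the power map separates [y] from [- y]. An even [a0] forces
     [M] to be odd, so [a0 + M] is odd. *)
  exists (a0 + M)%N, (b0 + h)%N; split; last by lia.
  have : odd (a0 * h) = odd (b0 * M + 1) by rewrite Eab.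
  by rewrite oddD !oddM oddD (negPf o) /=; case: (odd M) => //; rewrite andbF.
have tE (y : F) : (y ^+ s) ^+ (p ^ u + 1) = y ^+ 2.
  rewrite -exprM -Eh mulnA Es mulnDl mul1n exprD.
  have [->|ny] := eqVneq y 0; first by rewrite [0 ^+ 2]expr0n mulr0.
  by rewrite -mulnA EM mulnC exprM -card_pred expf_card_pred // expr1n mul1r.
exists (fun y => y ^+ s) => // x y /= E.
have : x ^+ 2 = y ^+ 2 by rewrite -!tE E.
move/eqP; rewrite eqf_sqr => /orP [/eqP //|/eqP Exy].
move: E; rewrite Exy exprNn -signr_odd os expr1 mulN1r => /eqP.
rewrite eq_sym -addr_eq0 -mulr2n -mulr_natl mulf_eq0 (negPf natr2_neq0).
by rewrite expf_eq0 => /andP [_ /eqP ->]; rewrite oppr0.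
Qed.

Lemma level_traceform_odd : odd (m %/ gcdn m u) ->
  exists2 N, (forall c, c \in prime_subfield F p -> c != 0 -> level traceform c = N)
    & (4 %| N)%N.
Proof.
move=> /square_substitution [t tI tE].
pose S (z : F * F) : F := tr p m (z.1 ^+ 2 + z.2 ^+ 2).
have lS c : level traceform c = level S c.
  apply: (level_bij (h := fun z => (z.1, t z.2))); last first.
    by move=> z; rewrite /traceform /S /= tE.
  by apply: injF_bij => [[x1 x2] [y1 y2]] [-> /tI ->].
exists (level S 1) => [c cFp nc|].
  rewrite lS; have [[a b] /= Eab] := sum_two_squares c.
  (* Multiplication of [x + y i] by [a + b i], a similitude of factor [a^2 + b^2 = c]. *)
  apply: (level_scale (h := fun z => (a * z.1 - b * z.2, b * z.1 + a * z.2))) => //.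
    apply: (@can_inj _ _ _ (fun z => ((a * z.1 + b * z.2) / c, (a * z.2 - b * z.1) / c))).
    by move=> [x y] /=; rewrite -Eab in nc *; congr (_, _); field.
  by move=> z; rewrite /S -trZ //= -Eab; congr (tr p m _); ring.
rewrite /level; apply: (@dvdn_free_iter _ (fun z : F * F => (- z.2, z.1))) => //.
- by move=> [x1 x2] [y1 y2] /= [/oppr_inj -> ->].
- by move=> z; rewrite !inE /S /= sqrrN addrC.
- by move=> [x y] _ /=; rewrite !opprK.
(* A point fixed by a proper iterate of the rotation is the origin, as 2 is nonzero in [F], and
   there [S] vanishes. *)
move=> [x y] i; rewrite inE => /eqP Sz i4; apply: contra_eq_neq Sz => E.
have opp_fix (w : F) : - w = w -> w = 0.
  move/eqP; rewrite -subr_eq0 -opprD oppr_eq0 -mulr2n -mulr_natl mulf_eq0.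
  by rewrite (negPf natr2_neq0) => /eqP.
suff [-> ->] : x = 0 /\ y = 0.
  by rewrite /S /= !expr0n addr0 tr0 eq_sym oner_neq0.
case: i i4 E => [|[|[|[|i]]]] //= _ [].
- by move=> E1 E2; move: E1; rewrite -E2 => /opp_fix ->.
- by move=> /opp_fix -> /opp_fix ->.
- by move=> E1 E2; move: E2; rewrite opprK in E1 *; rewrite E1 => /opp_fix ->.
Qed.

(** * The case of [m / v] congruent to 2 modulo 4 *)

Lemma even_quotient : ((m %/ gcdn m u) %% 4 == 2)%N ->
  exists a b, [/\ odd a, odd b, m = (2 * (gcdn m u * a))%N & u = (gcdn m u * b)%N].
Proof.
move=> /eqP E4.
have Em := divnK (dvdn_gcdl m u); have Eu := divnK (dvdn_gcdr m u).
exists (m %/ gcdn m u %/ 2)%N, (u %/ gcdn m u)%N; split.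
- by lia.
- apply/negPn/negP => o.
  have v0 : (0 < gcdn m u)%N by rewrite gcdn_gt0 hm.
  (* If [u / v] were even, [2v] would divide both [m] and [u]. *)
  have : (gcdn m u * 2 %| gcdn m u)%N.
    rewrite dvdn_gcd -[X in (_ %| X)%N && _]Em -[X in _ && (_ %| X)%N]Eu.
    rewrite !(mulnC _ (gcdn m u)) !dvdn_mul ?dvdn2 //; lia.
  by move/(dvdn_leq v0); lia.
- rewrite -{1}Em mulnCA mulnC; congr muln.
  by move: E4; move: (m %/ gcdn m u)%N => n; lia.
- by rewrite mulnC Eu.
Qed.

(** For [0 < i < d] the factor [zeta ^+ i] is not 1, so a nonzero second coordinate is moved. Where
    it vanishes the first coordinate must be moved instead, whence the alternative with
    [xi == zeta]. *)
Lemma dvdn_free_scaling d (xi zeta : F) (A : {set F * F}) :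
  (0 < d)%N -> d.-primitive_root zeta -> xi ^+ d = 1 ->
  (forall z, ((xi * z.1, zeta * z.2) \in A) = (z \in A)) ->
  (forall z, z \in A -> (z.2 != 0) || (xi == zeta) && (z.1 != 0)) ->
  (d %| #|A|)%N.
Proof.
move=> d0 zP xd fA nA.
have nxi : xi != 0 by apply: contra_eq_neq xd => ->; rewrite expr0n gtn_eqF // eq_sym oner_neq0.
have zd := prim_expr_order zP.
have nze : zeta != 0 by apply: contra_eq_neq zd => ->; rewrite expr0n gtn_eqF // eq_sym oner_neq0.
pose f (z : F * F) := (xi * z.1, zeta * z.2).
have itf i z : iter i f z = (xi ^+ i * z.1, zeta ^+ i * z.2).
  elim: i => [|i IH]; first by rewrite !mul1r -surjective_pairing.
  by rewrite iterS IH /f /= !exprS !mulrA.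
have zi i : (0 < i < d)%N -> zeta ^+ i != 1.
  by move=> /andP [i0 id]; rewrite -(prim_order_dvd zP) gtnNdvd.
apply: (@dvdn_free_iter _ f) => //.
- by move=> [x1 x2] [y1 y2] [/(mulfI nxi) -> /(mulfI nze) ->].
- by move=> [x y] _; rewrite itf xd zd !mul1r.
move=> [x y] i /nA /= nz /zi ni; rewrite itf -pair_eqE /= negb_and.
have fixP (w s : F) : w != 0 -> (s * w == w) = (s == 1).
  by move=> nw; rewrite -{2}[w]mul1r (inj_eq (mulIf nw)).
case/orP: nz => [ny|/andP [/eqP -> nx]]; first by rewrite (fixP y) // ni orbT.
by rewrite (fixP x) // ni.
Qed.

Section EvenQuotient.

Variables v a b : nat.
Hypotheses (oa : odd a) (ob : odd b)
  (Em : m = (2 * (v * a))%N) (Eu : u = (v * b)%N).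

(** [F] is quadratic over its subfield with [p ^ k] elements, and [x ^+ (p ^ k)] is the conjugate of
    [x]. *)
Let k := (v * a)%N.

Let p0 : (0 < p)%N := prime_gt0 (pcharf_prime hchar).

Lemma dvdn_expS_u : ((p ^ v).+1 %| p ^ u + 1)%N.
Proof. by rewrite addn1 Eu expnM odd_dvdn_expS. Qed.

Lemma dvdn_expS_k : ((p ^ v).+1 %| (p ^ k).+1)%N.
Proof. by rewrite /k expnM odd_dvdn_expS. Qed.

Lemma card_pred_k : #|F|.-1 = ((p ^ k).-1 * (p ^ k).+1)%N.
Proof.
rewrite card_pred Em mulnC expnM -/k -{2}(exp1n 2) subn_sqr addn1.
by rewrite subn1.
Qed.

Lemma conjK (x : F) : (x ^+ (p ^ k)) ^+ (p ^ k) = x.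
Proof. by have := exprp_card x 1; rewrite mul1n Em mul2n -addnn expnD exprM. Qed.

(** Since [c ^+ (p ^ k).-1 = 1] and [(p ^ v).+1] divides [(p ^ k).+1], a root [mu] exists. Raising
    to the power [p ^ v] exchanges [mu] and [c / mu]; as [b] is odd, the power [p ^ u] also sends
    [mu] to [c / mu]. *)
Lemma exists_similitude c : c \in prime_subfield F p -> c != 0 ->
  exists mu : F, mu ^+ (p ^ v).+1 = c /\ mu ^+ (p ^ u + 1) = c.
Proof.
move=> cFp nc; have dv := dvdn_expS_k.
have dq : ((p ^ v).+1 %| #|F|.-1)%N by rewrite card_pred_k dvdn_mull.
have [|mu E] := power_residue dq nc.
  rewrite card_pred_k -muln_divA // exprM.
  suff -> : c ^+ (p ^ k).-1 = 1 by rewrite expr1n.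
  by apply: (mulfI nc); rewrite -exprS prednK ?expn_gt0 ?p0 // expr_prime_subfield ?mulr1.
exists mu; split => //.
have nmu : mu != 0 by apply: contraNneq nc => m0; rewrite -E m0 expr0n.
have mv : mu ^+ (p ^ v) = c / mu by rewrite -E exprSr mulfK.
suff : mu ^+ (p ^ u) = c / mu by rewrite exprD expr1 => ->; rewrite divfK.
rewrite Eu -(odd_double_half b) ob add1n; elim: (b./2) => [|j IH]; first by rewrite muln1.
rewrite doubleS -2![in LHS]addn1 -addnA mulnDr expnD exprM IH addn1 muln2 -addnn.
have cv := expr_prime_subfield v cFp.
rewrite expnD exprM !(exprMn, exprVn) mv !cv !(exprMn, exprVn) mv cv.
by field; rewrite nc nmu.
Qed.

Lemma level_traceform_even c : c \in prime_subfield F p -> c != 0 ->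
  level traceform c = level traceform 1.
Proof.
move=> cFp nc; have [mu [Ev EU]] := exists_similitude cFp nc.
have ov := odd_exp v.
have E2 : (mu ^+ ((p ^ v).+1 %/ 2)) ^+ 2 = c.
  by rewrite -exprM divnK ?dvdn2 //= ov.
have nmu : mu != 0 by apply: contraNneq nc => m0; rewrite -Ev m0 expr0n.
apply: (level_scale (h := fun z => (mu ^+ ((p ^ v).+1 %/ 2) * z.1, mu * z.2))) => //.
  by move=> [x1 x2] [y1 y2] [/(mulfI (expf_neq0 _ nmu)) -> /(mulfI nmu) ->].
by move=> z; rewrite /traceform -trZ //= !exprMn E2 EU mulrDr.
Qed.

Lemma exists_sqrtN1 : exists i : F, i ^+ 2 = -1.
Proof.
have ok := odd_exp k; have k0 : (0 < p ^ k)%N by rewrite expn_gt0 p0.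
apply: power_residue; rewrite ?oppr_eq0 ?oner_neq0 // card_pred_k.
  by rewrite dvdn_mull // dvdn2 /= ok.
rewrite -muln_divA ?dvdn2 //= ?ok // exprM -signr_odd.
by rewrite -subn1 oddB // ok expr1n.
Qed.

(** The sign tells whether [i] lies in the subfield with [p ^ k] elements, which decides between the
    two arguments below. *)
Lemma conj_sqrtN1 (i : F) : i ^+ 2 = -1 -> i ^+ (p ^ k) = (-1) ^+ ((p ^ k) %/ 2) * i.
Proof.
move=> E; have ok := odd_exp k.
by rewrite -E -exprM -exprSr; congr (_ ^+ _); lia.
Qed.

Lemma tr_mul_conj (x y : F) : tr p m (x * y ^+ (p ^ k)) = tr p m (x ^+ (p ^ k) * y).
Proof. by apply: tr_mul_exprp; rewrite Em addnn mul2n. Qed.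

(* Writing [x = s + d] with [s], [d] the [+1] and [-1] eigenvectors of the
   involution [x ^+ (p ^ k)], the isometry maps [x] to [s + i * d]. *)
Lemma square_norm_isometry (i : F) : i ^+ 2 = -1 -> i ^+ (p ^ k) = i ->
  exists2 T : F -> F, injective T & forall x, tr p m (T x ^+ (p ^ k).+1) = tr p m (x ^+ 2).
Proof.
move=> i2 ci; have n2 := natr2_neq0.
have Fp2 : 2^-1 \in prime_subfield F p.
  by rewrite prime_subfieldV // (natr_prime_subfield hchar 2).
have ch : 2^-1 ^+ (p ^ k) = 2^-1 :> F := expr_prime_subfield k Fp2.
pose T j x : F := 2^-1 * ((1 + j) * x + (1 - j) * x ^+ (p ^ k)).
have cT j x : j ^+ (p ^ k) = j ->
    T j x ^+ (p ^ k) = 2^-1 * ((1 + j) * x ^+ (p ^ k) + (1 - j) * x).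
  by move=> cj; rewrite exprMn ch exprDp !exprMn !exprDp exprNp expr1n cj conjK.
exists (T i) => [|x].
  apply: (@can_inj _ _ _ (T (- i))) => x; rewrite {1}/T cT // /T.
  move: (x ^+ (p ^ k)) => y.
  transitivity (2^-1 * 2^-1 * (2%:R * (1 - i ^+ 2) * x + 2%:R * (1 + i ^+ 2) * y)).
    by field.
  by rewrite i2; field.
rewrite exprS cT //.
transitivity (tr p m (2^-1 * (x ^+ 2 + (x ^+ 2) ^+ (p ^ k)))); last first.
  by rewrite trZ // tr_add tr_exprp; field.
congr (tr p m _); rewrite -exprM mulnC exprM /T; move: (x ^+ (p ^ k)) => y.
transitivity (2^-1 * 2^-1 * ((2%:R + 2%:R * i ^+ 2) * x * y + (1 - i ^+ 2) * (x ^+ 2 + y ^+ 2))).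
  by field.
by rewrite i2; field.
Qed.

Lemma expr_dvd_prim_root d n (z : F) : (d %| n)%N -> d.-primitive_root z -> z ^+ n = 1.
Proof. by move=> /dvdnP [j ->] /prim_expr_order E; rewrite mulnC exprM E expr1n. Qed.

(** Once [x^2] is replaced by the norm of [x], the [(p ^ v).+1]-th roots of unity act on both
    coordinates at once, freely away from the origin. *)
Lemma dvdn_level_traceform (i : F) : i ^+ 2 = -1 -> i ^+ (p ^ k) = i ->
  ((p ^ v).+1 %| level traceform 1%R)%N.
Proof.
move=> i2 ci; have [T TI TE] := square_norm_isometry i2 ci.
pose S (z : F * F) : F := tr p m (z.1 ^+ (p ^ k).+1 + z.2 ^+ (p ^ u + 1)).
have -> : level traceform 1 = level S 1.
  apply/esym/(level_bij (h := fun z => (T z.1, z.2))).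
    by apply: injF_bij => [[x1 x2] [y1 y2]] [/TI -> ->].
  by move=> z; rewrite /traceform /S !tr_add TE.
have dk := dvdn_expS_k; have du := dvdn_expS_u.
have [|zeta zP] := @prim_root_dvd_card F (p ^ v).+1.
  by rewrite card_pred_k dvdn_mull.
apply: (@dvdn_free_scaling _ zeta zeta) => //; first exact: prim_expr_order.
  move=> z; rewrite !inE /S !exprMn (expr_dvd_prim_root dk zP) (expr_dvd_prim_root du zP).
  by rewrite !mul1r.
move=> [x y]; rewrite inE /S /= eqxx /= => /eqP E.
rewrite orbC -negb_and; apply/negP => /andP [/eqP x0 /eqP y0].
move/eqP: E; rewrite x0 y0 addn1 !expr0n addr0 tr0 eq_sym.
by rewrite (negPf (oner_neq0 _)).
Qed.

(** The roots of unity act on [y] alone, freely where [y != 0]; the first summand counts the points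
    with [y = 0]. *)
Lemma level_traceform_split : exists n,
  level traceform 1 = (level (fun x : F => tr p m (x ^+ 2)%R) 1%R + (p ^ v).+1 * n)%N.
Proof.
have du := dvdn_expS_u; have dk := dvdn_expS_k.
have [|zeta zP] := @prim_root_dvd_card F (p ^ v).+1.
  by rewrite card_pred_k dvdn_mull.
suff /dvdnP [n E] : ((p ^ v).+1 %| #|[set z : F * F | (traceform z == 1%R) && (z.2 != 0%R)]|)%N.
  exists n; rewrite mulnC -E /level -(cardsID [set z : F * F | z.2 == 0]); congr addn.
    rewrite -(@card_imset _ _ (fun x : F => (x, 0 : F))) => [|x y [] //].
    apply: eq_card => [[x y]]; rewrite !inE /=; apply/andP/imsetP => [[Q1 /eqP y0]|[t]].
      by exists x; rewrite ?y0 // inE; move: Q1; rewrite y0 /traceform /= addn1 expr0n addr0.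
    by rewrite inE => tE [-> ->]; rewrite /traceform /= addn1 expr0n addr0.
  by apply: eq_card => z; rewrite !inE andbC.
apply: (@dvdn_free_scaling _ 1 zeta) => //; first exact: expr1n.
- move=> z; rewrite !inE /traceform /= mul1r !exprMn (expr_dvd_prim_root du zP) mul1r.
  suff nz : zeta != 0 by rewrite mulf_eq0 (negPf nz).
  by apply: contra_eq_neq (prim_expr_order zP) => ->; rewrite expr0n eq_sym oner_neq0.
- by move=> z; rewrite inE => /andP [_ ->].
Qed.

(** * A totally isotropic subspace for [Tr(x^2)] *)

Section Hyperbolic.

Variable i : F.
Hypotheses (i2 : i ^+ 2 = -1) (ci : i ^+ (p ^ k) = - i).

Definition lagrangian : {set F} := [set x | x ^+ (p ^ k) == i * x].

(** An additive map whose kernel and image are both [lagrangian]. *)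
Let psi (f : F) : F := f ^+ (p ^ k) - i * f.

Let psi_lagrangian f : psi f \in lagrangian.
Proof.
rewrite inE /psi exprDp exprNp exprMn conjK ci.
by apply/eqP; rewrite mulrBr mulrA -expr2 i2; ring.
Qed.

(** Raising [x * y] to the power [p ^ k] multiplies it by [i^2 = -1] and keeps its trace. *)
Lemma tr_lagrangian x y : x \in lagrangian -> y \in lagrangian -> tr p m (x * y) = 0.
Proof.
rewrite !inE => /eqP cx /eqP cy; have E := tr_exprp (x * y) k.
apply/eqP; rewrite -(mulrI_eq0 _ (mulfI natr2_neq0)) mulr_natl mulr2n -{1}E.
by rewrite exprMn cx cy mulrACA -expr2 i2 mulN1r trN addNr.
Qed.

Lemma card_lagrangian : #|lagrangian| = (p ^ k)%N.
Proof.
apply/eqP; rewrite -(@eqn_exp2r _ _ 2) // -expnM mulnC -Em -hcard -mulnn; apply/eqP.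
rewrite -(sum_level psi_lagrangian) -sum_nat_const; apply: eq_bigr => w.
rewrite inE => /eqP wW.
have -> : #|lagrangian| = level psi 0.
  by apply: eq_card => x; rewrite !inE subr_eq0.
(* [2^-1 * (i * w)] is a preimage of [w] under [psi], so all fibres over [lagrangian] have the size
   of the kernel and [#|lagrangian|] squared is [#|F|]. *)
apply/esym/(level_bij (h := fun f => f + 2^-1 * (i * w))).
  by exists (fun f => f - 2^-1 * (i * w)) => f; rewrite ?addrK ?subrK.
have ch : 2^-1 ^+ (p ^ k) = 2^-1 :> F.
  by apply: expr_prime_subfield; rewrite prime_subfieldV // (natr_prime_subfield hchar 2).
move=> f; rewrite /psi exprDp !exprMn ch ci wW -subr_eq0; congr (_ == _).
transitivity (f ^+ (p ^ k) - i * f - 2^-1 * 2%:R * (i ^+ 2) * w - w).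
  by ring.
by rewrite i2 mulVf ?natr2_neq0 //; ring.
Qed.

(* Averaging over translates of [x] by the totally isotropic [lagrangian]. *)
Lemma level_tr_sqr : (p * level (fun x : F => tr p m (x ^+ 2)%R) 1%R + p ^ k = p ^ m)%N.
Proof.
set N := level _ _.
have E : (\sum_f level (fun x : F => tr p m ((x + psi f) ^+ 2)%R) 1%R = #|F| * N)%N.
  rewrite -sum_nat_const; apply: eq_bigr => f _.
  apply/esym/(level_bij (h := fun x => x + psi f)).
    by exists (fun x => x - psi f) => x; rewrite ?addrK ?subrK.
  by [].
pose g x f : F := tr p m (2%:R * (x * psi f)).
(* For fixed [x] this is a linear form in [f], zero exactly when [x] lies in [lagrangian]. *)
have gE x f : g x f = tr p m (2%:R * (x ^+ (p ^ k) - i * x) * f).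
  rewrite /g /psi -!mulrA !(trZ _ (natr_prime_subfield hchar 2)); congr (_ * _).
  rewrite mulrBr mulrBl !tr_add !trN tr_mul_conj; congr (_ - tr p m _); ring.
have E2 : (\sum_f level (fun x : F => tr p m ((x + psi f) ^+ 2)%R) 1%R
           = \sum_x level (g x) (1 - tr p m (x ^+ 2))%R)%N.
  rewrite /level; under eq_bigr do rewrite card_sum_nat.
  rewrite exchange_big /=; apply: eq_bigr => x _; rewrite card_sum_nat.
  apply: eq_bigr => f _; congr nat_of_bool.
  have -> : (x + psi f) ^+ 2 = x ^+ 2 + psi f * psi f + 2%:R * (x * psi f) by ring.
  rewrite !tr_add (tr_lagrangian (psi_lagrangian f) (psi_lagrangian f)) addr0.
  by rewrite -subr_eq0 -[RHS]subr_eq0 /g; congr (_ == _); ring.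
(* For [x] in [lagrangian] the equation reads [0 = 1]; otherwise the linear form takes each value of
   the prime field [#|F| / p] times. *)
have E3 : (p * \sum_x level (g x) (1 - tr p m (x ^+ 2))%R = (#|F| - p ^ k) * #|F|)%N.
  rewrite (bigID (mem lagrangian)) /= big1 => [|x xW]; last first.
    rewrite expr2 tr_lagrangian // subr0 /level; apply/eqP; rewrite cards_eq0.
    apply/eqP/setP => f; rewrite !inE /g (trZ _ (natr_prime_subfield hchar 2)).
    by rewrite tr_lagrangian // mulr0 eq_sym (negPf (oner_neq0 _)).
  rewrite add0n big_distrr /= (eq_bigr (fun=> #|F|)) => [|x nW].
    rewrite sum_nat_const -card_lagrangian -(cardsC lagrangian) addKn; congr muln.
    by apply: eq_card => x; rewrite [LHS]unfold_in in_setC.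
  have [f nf] : exists f, g x f != 0.
    have := @tr_nondegenerate (2%:R * (x ^+ (p ^ k) - i * x)).
    rewrite mulf_neq0 ?natr2_neq0 ?subr_eq0 //; last by rewrite inE in nW.
    by case=> // f nf; exists f; rewrite gE.
  apply: (level_additive hchar _ _ nf).
  - by move=> f1 f2; rewrite !gE mulrDr tr_add.
  - by move=> f1; apply: tr_prime_subfield.
  - rewrite !(prime_subfieldD hchar, prime_subfieldN hchar) ?tr_prime_subfield //.
    exact: (natr_prime_subfield hchar 1).
have le_k : (p ^ k <= p ^ m)%N by rewrite leq_exp2l ?prime_gt1 ?(pcharf_prime hchar) // Em; lia.
have q0 : (0 < p ^ m)%N by rewrite expn_gt0 p0.
move: E3; rewrite -E2 E hcard mulnCA [RHS]mulnC => /eqP.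
by rewrite eqn_pmul2l // => /eqP ->; rewrite subnK.
Qed.

End Hyperbolic.

End EvenQuotient.

(** * Determination of the level size *)

Lemma exp_odd_mod4 n : (p ^ n %% 4 = if (p %% 4 == 3) && odd n then 3 else 1)%N.
Proof.
have p4 : (p %% 4 = 1 \/ p %% 4 = 3)%N by lia.
elim: n => [|n IH]; first by rewrite andbF.
by rewrite expnS -modnMm IH /=; case: p4 => -> /=; case: (odd n).
Qed.

Lemma level_traceform_value : exists N,
  (forall c, c \in prime_subfield F p -> c != 0 -> level traceform c = N) /\
  (if (p %% 4 == 3) && odd (gcdn m u) then p * N = p ^ m * p ^ m + p ^ m
   else p * N + p ^ m = p ^ m * p ^ m)%N.
Proof.
have p1 := prime_gt1 (pcharf_prime hchar).
have sqrtE N : (forall c, c \in prime_subfield F p -> c != 0 -> level traceform c = N) ->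
    (p * N = p ^ m * p ^ m + p ^ m)%N \/ (p * N + p ^ m = p ^ m * p ^ m)%N.
  move/(levelN_quadratic hchar traceform_prime_subfield
          polar_traceformD traceform_nondegenerate).
  rewrite card_prod hcard; move: (p ^ m)%N (p * N)%N => q x.
  rewrite PoszM -expr2 => /eqP; rewrite eqf_sqr => /orP [] /eqP; lia.
case/orP: hmv => [oN|E4].
  (* With [q = p ^ m], divisibility by 4 selects [q^2 + q] if [q] is 3 modulo 4 and [q^2 - q] if it
     is 1. *)
  have [N lN /dvdnP [j Ej]] := level_traceform_odd oN.
  exists N; split=> //; have Em := divnK (dvdn_gcdl m u).
  have := exp_odd_mod4 m; have := sqrtE N lN.
  have -> : odd m = odd (gcdn m u) by rewrite -[in LHS]Em oddM oN.
  rewrite Ej mulnA; move: (p * j)%N (p ^ m)%N => x q.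
  case: ifP => _ Eq Emod.
    have {}Emod : (q = 4 * (q %/ 4) + 3)%N by lia.
    move: Eq; rewrite Emod; move: (q %/ 4)%N => t; case=> //; lia.
  have {}Emod : (q = 4 * (q %/ 4) + 1)%N by lia.
  move: Eq; rewrite Emod; move: (q %/ 4)%N => t; case=> //; lia.
have [a [b [oa ob Em Eu]]] := even_quotient E4.
set v := gcdn m u in Em Eu *; have v0 : (0 < v)%N by rewrite gcdn_gt0 hm.
have lN := level_traceform_even oa ob Em Eu.
exists (level traceform 1); split=> //.
have [i i2] := exists_sqrtN1 Em.
have ci := conj_sqrtN1 oa ob Em Eu i2.
have dk := dvdn_expS_k v oa.
have e4 : (4 <= (p ^ v).+1)%N.
  by rewrite ltnS -[3%N]expn1 (leq_trans (n := p ^ 1)) ?leq_exp2l // expn1; lia.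
(* In both branches below the wrong sign would make [(p ^ v).+1] divide 2, because [p ^ m] is 1
   modulo [(p ^ v).+1]. *)
have ne2 : ~~ ((p ^ v).+1 %| 2)%N by apply/negP => /(dvdn_leq (isT : (0 < 2)%N)); lia.
have dq : ((p ^ v).+1 %| p ^ m - 1)%N.
  by rewrite -card_pred (card_pred_k Em) dvdn_mull.
have q0 : (0 < p ^ m)%N by rewrite expn_gt0 (ltnW p1).
have := exp_odd_mod4 (v * a); rewrite oddM oa andbT.
have := sqrtE _ lN; case: ifP => c1 [] // E Emod; case/negP: ne2.
- have ci' : i ^+ (p ^ (v * a)) = - i.
    rewrite ci (_ : p ^ (v * a) %/ 2 = (p ^ (v * a) %/ 4).*2.+1)%N; last by lia.
    by rewrite exprS -mul2n exprM sqrrN !expr1n mulr1 mulN1r.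
  have [n En] := level_traceform_split oa ob Em Eu.
  have EN1 := level_tr_sqr oa ob Em Eu i2 ci'.
  (* With [q = p ^ m] and [k = v * a], the number [(q - 1)^2 + (p^k + 1)] is a multiple of
     [(p ^ v).+1], while [E], [En] and [EN1] make it such a multiple plus 2. *)
  have := dvdn_add (dvdn_mulr (p ^ m - 1) dq) dk.
  rewrite (_ : _ + _ = (p ^ v).+1 * (p * n) + 2)%N; last first.
    rewrite En mulnDr mulnCA in E; move: E EN1 q0 {En lN}.
    move: (p * level _ _)%N ((p ^ v).+1 * (p * n))%N (p ^ (v * a))%N => x y P.
    by case: (p ^ m)%N => // q; rewrite subn1 /=; lia.
  by rewrite dvdn_addr ?dvdn_mulr.
- have ci' : i ^+ (p ^ (v * a)) = i.
    rewrite ci (_ : p ^ (v * a) %/ 2 = (p ^ (v * a) %/ 4).*2)%N; last by lia.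
    by rewrite -mul2n exprM sqrrN !expr1n mul1r.
  have := dvdn_level_traceform oa ob Em Eu i2 ci'.
  move/(dvdn_mull p); rewrite E.
  rewrite (_ : _ + _ = (p ^ m - 1) * (p ^ m + 2) + 2)%N; last first.
    by move: q0; move: (p ^ m)%N => [|q] // _; rewrite subn1 /=; nia.
  by rewrite dvdn_addr ?dvdn_mulr.
Qed.

(** * Codewords and their weights *)

Lemma traceform0 : traceform 0 = 0.
Proof. by rewrite /traceform /= addn1 !expr0n addr0 tr0. Qed.

(** The extra 1 is the origin, a zero of the form that [D2] leaves out. *)
Lemma card_D2 : level traceform 0 = #|D2 F p m u|.+1.
Proof.
rewrite /level (cardsD1 0) inE traceform0 eqxx add1n; congr _.+1.
by apply: eq_card => z; rewrite !inE.
Qed.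

Lemma wt_cw (a b : F) : wt (cw p m u a b) =
  #|[set z | (traceform z == 0) && (tr p m (a * z.1 + b * z.2) != 0)]|.
Proof.
rewrite /wt /cw count_map -sum1_count big_enum_cond /= -sum1_card.
apply: eq_bigl => z; rewrite !inE /=.
by have [->|] := eqVneq z 0; rewrite //= !mulr0 addr0 tr0 eqxx !andbF.
Qed.

Lemma addw_cw (a b c d : F) :
  addw (cw p m u a b) (cw p m u c d) = cw p m u (a + c) (b + d).
Proof.
rewrite /addw /cw zip_map -map_comp; apply: eq_map => z /=.
by rewrite -tr_add; congr (tr p m _); ring.
Qed.

(** By additivity, the difference of two parameters with the same codeword has a codeword of weight
    0. *)
Lemma cw_inj_of_wt :
  (forall ab : F * F, ab != 0 -> wt (cw p m u ab.1 ab.2) != 0%N) ->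
  injective (fun ab : F * F => cw p m u ab.1 ab.2).
Proof.
move=> nz x y E; apply/eqP; rewrite -subr_eq0; apply: contraT => /nz.
have /(congr1 (@wt F)) : addw (cw p m u x.1 x.2) (cw p m u (- y).1 (- y).2)
    = addw (cw p m u y.1 y.2) (cw p m u (- y).1 (- y).2) by rewrite /= E.
rewrite !addw_cw => ->; rewrite wt_cw cards_eq0; case/negP; apply/eqP/setP => z.
by rewrite !inE /= !subrr !mul0r addr0 tr0 eqxx andbF.
Qed.

(** Indexing codewords by [polar_dual w] makes the weight for [w != 0] depend only on whether [w] is
    isotropic. Everything is expressed through [r], with [p ^ m = p * r]. *)
Lemma weights_of_polar_dual :
  let r := (p ^ m.-1)%N in
  let case1 := ((p %% 4 == 3)%N && odd (gcdn m u)) in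
  [/\ #|D2 F p m u| = if case1 then ((p ^ m + 1) * (r - 1))%N
                      else ((p ^ m - 1) * (r + 1))%N,
      forall w, w != 0 -> traceform w = 0 ->
        wt (cw p m u (polar_dual w).1 (polar_dual w).2) = ((p - 1) * (r * r))%N,
      forall w, traceform w != 0 ->
        wt (cw p m u (polar_dual w).1 (polar_dual w).2) =
          if case1 then ((p - 1) * (r * r - r))%N else ((p - 1) * (r * r + r))%N
    & #|[set w | traceform w != 0%R]| =
        if case1 then ((p ^ m + 1) * r * (p - 1))%N
        else ((p ^ m - 1) * r * (p - 1))%N].
Proof.
move=> r case1.
have p1 := prime_gt1 (pcharf_prime hchar).
have r0 : (0 < r)%N by rewrite expn_gt0 (ltnW p1).
have qE : (p ^ m = p * r)%N by rewrite -{1}(prednK hm) expnS.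
have [N [lN]] := level_traceform_value; rewrite -/case1 => EN.
have := level0_levelN hchar traceform_prime_subfield lN.
rewrite card_prod hcard qE => E0.
have {}EN : (N = if case1 then r * (p * r + 1) else r * (p * r - 1))%N.
  rewrite qE in EN; move: EN {lN E0 qE}; case: case1 => EN.
    by apply/eqP; rewrite -(eqn_pmul2l (ltnW p1)) EN; apply/eqP; ring.
  apply/eqP; rewrite -(eqn_pmul2l (ltnW p1)) -(eqn_add2r (p * r)) EN; apply/eqP.
  by rewrite !mulnBr muln1 mulnA subnK ?leq_pmulr ?muln_gt0 ?r0 ?(ltnW p1) //; lia.
have rr : (r <= r * r)%N by rewrite leq_pmulr.
have cardD : #|D2 F p m u| = if case1 then ((p * r + 1) * (r - 1))%N
                             else ((p * r - 1) * (r + 1))%N.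
  have := E0; rewrite card_D2 EN; move: (#|_|) => d {E0 EN lN qE}.
  (* Writing [p] and [r] as successors removes the truncated subtractions. *)
  have : (p = (p - 1).+1)%N by lia.
  have : (r = (r - 1).+1)%N by lia.
  move: (r - 1)%N (p - 1)%N => r' p' Er Ep.
  move: {rr r0 p1} Er Ep; case: case1 => Er Ep; rewrite {}Er {}Ep; nia.
have lvl0 := card_D2.
have wE w : #|[set z | (traceform z == 0) && (polar traceform w z != 0)]| =
    wt (cw p m u (polar_dual w).1 (polar_dual w).2).
  rewrite wt_cw; apply: eq_card => z; rewrite !inE; congr (_ && (_ != _)).
  exact: polar_traceform.
have p20 : (0 < p ^ 2)%N by rewrite expn_gt0 (ltnW p1).
split=> //.
- move=> w nw Qw.
  have := weight_isotropic hchar traceform_even traceform_prime_subfield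
    polar_traceformD traceform_nondegenerate nw Qw.
  rewrite wE card_prod hcard qE => E.
  by apply/eqP; rewrite -(eqn_pmul2l p20) E; apply/eqP; ring.
- move=> w Qw.
  have := weight_anisotropic hchar traceform_even traceform_prime_subfield
    polar_traceformD traceform_nondegenerate lN Qw.
  rewrite wE card_prod hcard qE lvl0 cardD => E.
  apply/eqP; rewrite -(eqn_pmul2l p20) -(eqn_add2r (p * r * (p * r))) E.
  rewrite (_ : p * r * (p * r) = p ^ 2 * (r * r))%N -?mulnDr ?eqn_pmul2l //; last by ring.
  have : (r * r - r = (r - 1) * r)%N by rewrite mulnBl mul1n.
  have : (p = (p - 1).+1)%N by lia.
  have : (r = (r - 1).+1)%N by lia.
  move: (r - 1)%N (p - 1)%N => r' p' Er Ep ->.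
  move: {E E0 EN lN cardD qE rr r0 p1 p20 lvl0 wE} Er Ep.
  by case: case1 => Er Ep; rewrite {}Er {}Ep; nia.
- have : (level traceform 0%R + #|[set w | traceform w != 0%R]| = p * r * (p * r))%N.
    rewrite -qE -hcard -card_prod -[RHS](cardsC [set w | traceform w == 0]).
    by congr addn; apply: eq_card => w; rewrite !inE.
  rewrite -E0 => /addnI ->; rewrite EN.
  by case: (case1); ring.
Qed.

Lemma wt_cw0 : wt (cw p m u (0 : F) 0) = 0%N.
Proof.
rewrite wt_cw; apply/eqP; rewrite cards_eq0; apply/eqP/setP => z.
by rewrite !inE !mul0r addr0 tr0 eqxx andbF.
Qed.

Lemma polar_dual0 : polar_dual 0 = 0.
Proof. by apply: (addrI (polar_dual 0)); rewrite -polar_dualD !addr0. Qed.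

Lemma polar_dual_bij : bijective polar_dual.
Proof. exact: injF_bij polar_dual_inj. Qed.

Lemma cw_prime_subfield (a b x : F) : x \in cw p m u a b -> x ^+ p = x.
Proof.
case/mapP => z _ ->; apply/eqP.
by have := tr_prime_subfield (a * z.1 + b * z.2); rewrite inE.
Qed.

Lemma size_cw (a b : F) : size (cw p m u a b) = #|D2 F p m u|.
Proof. by rewrite size_map -cardE. Qed.

Lemma codeP c : reflect (exists ab : F * F, c = cw p m u ab.1 ab.2) (c \in code F p m u).
Proof.
rewrite mem_undup; apply: (iffP mapP) => [[ab _ ->]|[ab ->]]; exists ab => //.
by rewrite mem_enum inE.
Qed.

(** Scalars of the prime field act as repeated sums, so closure under addition gives linearity. *)
Lemma code_addw c d : c \in code F p m u -> d \in code F p m u -> addw c d \in code F p m u.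
Proof.
move=> /codeP [ab ->] /codeP [cd ->]; apply/codeP.
by exists (ab.1 + cd.1, ab.2 + cd.2); rewrite addw_cw.
Qed.

(** * Dimension and weight distribution *)

Section TwoWeights.

Variables w1 w2 : nat.
Hypotheses (w1n : w1 != 0%N) (w2n : w2 != 0%N) (w12 : w1 != w2).
Hypothesis wt_zero : forall w, w != 0 -> traceform w = 0 ->
  wt (cw p m u (polar_dual w).1 (polar_dual w).2) = w1.
Hypothesis wt_nonzero : forall w, traceform w != 0 ->
  wt (cw p m u (polar_dual w).1 (polar_dual w).2) = w2.

Lemma wt_polar_dual w : wt (cw p m u (polar_dual w).1 (polar_dual w).2) =
  if w == 0 then 0%N else if traceform w == 0 then w1 else w2.
Proof.
case: (eqVneq w 0) => [->|nz]; first by rewrite polar_dual0 wt_cw0.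
by case: (eqVneq (traceform w) 0) => Qz; [apply: wt_zero | apply: wt_nonzero].
Qed.

Lemma cw_inj : injective (fun ab : F * F => cw p m u ab.1 ab.2).
Proof.
apply: cw_inj_of_wt => ab; have [psi _ psiK] := polar_dual_bij.
rewrite -[ab]psiK wt_polar_dual; case: (eqVneq (psi ab) 0) => [->|_ _].
  by rewrite polar_dual0 => /eqP.
by case: ifP.
Qed.

Lemma codeE : code F p m u = [seq cw p m u ab.1 ab.2 | ab <- enum [set: F * F]].
Proof. by rewrite /code undup_id // map_inj_uniq ?enum_uniq //; apply: cw_inj. Qed.

Lemma size_code : size (code F p m u) = (p ^ m * p ^ m)%N.
Proof. by rewrite codeE size_map -cardE cardsT card_prod hcard. Qed.

Lemma wt_code c : c \in code F p m u -> wt c \in [:: 0%N; w1; w2].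
Proof.
move=> /codeP [ab ->]; have [psi _ psiK] := polar_dual_bij.
rewrite -[ab]psiK wt_polar_dual !inE; case: ifP => // _.
by case: ifP => _; rewrite eqxx ?orbT.
Qed.

Lemma count_wt x (P : pred (F * F)) :
  (forall w, (wt (cw p m u (polar_dual w).1 (polar_dual w).2) == x) = P w) ->
  count (fun c => wt c == x) (code F p m u) = #|[set w | P w]|.
Proof.
move=> E; rewrite codeE count_map -sum1_count big_enum_cond /=.
transitivity (level (fun ab : F * F => wt (cw p m u ab.1 ab.2)) x).
  by rewrite /level -sum1_card; apply: eq_bigl => ab; rewrite !inE.
pose f w := wt (cw p m u (polar_dual w).1 (polar_dual w).2).
rewrite (level_bij (f := f) (c := x) polar_dual_bij) //.
by apply: eq_card => w; rewrite !inE -E.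
Qed.

Lemma count_wt0 : count (fun c => wt c == 0%N) (code F p m u) = 1%N.
Proof.
rewrite (@count_wt 0%N (pred1 0)) => [|w].
  by rewrite -(cards1 (0 : F * F)); apply: eq_card => z; rewrite !inE.
rewrite wt_polar_dual /=; case: (eqVneq w 0) => // _.
by case: ifP => _; apply/negbTE.
Qed.

(** The nonzero zeros of the form are the points of [D2], so this multiplicity equals the length. *)
Lemma count_wt1 : count (fun c => wt c == w1) (code F p m u) = #|D2 F p m u|.
Proof.
rewrite (@count_wt w1 (mem (D2 F p m u))) => [|w].
  by apply: eq_card => z; rewrite inE.
rewrite wt_polar_dual /= inE; case: (eqVneq w 0) => [_|nz] /=.
  by rewrite (eq_sym 0%N) (negPf w1n).
rewrite -/(traceform w); case: (eqVneq (traceform w) 0) => _; first by rewrite eqxx.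
by rewrite eq_sym (negPf w12).
Qed.

Lemma count_wt2 :
  count (fun c => wt c == w2) (code F p m u) = #|[set w | traceform w != 0%R]|.
Proof.
apply: count_wt => w; rewrite wt_polar_dual.
case: (eqVneq w 0) => [->|nz].
  by rewrite traceform0 eqxx (eq_sym 0%N) (negPf w2n).
by case: (eqVneq (traceform w) 0) => _; rewrite ?eqxx ?(negPf w12).
Qed.

End TwoWeights.

End Trace.

(** [hdeg] excludes [m = 1] with [p] congruent to 3 modulo 4 and [v] odd, where [D2] is empty and
    [w2] is 0. The second weight is multiplied out to avoid fractions, and dimension [2m] is
    expressed by the number of codewords. *)
Theorem theorem5 (F : finFieldType) (p m u : nat)
  (hp : prime p) (hodd : odd p) (hchar : (p \in [pchar F])%N)
  (hm : (0 < m)%N) (hcard : #|F| = (p ^ m)%N) (hu : (0 < u)%N)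
  (hmv : odd (m %/ gcdn m u) || ((m %/ gcdn m u) %% 4 == 2)%N)
  (hdeg : (1 < m)%N || ~~ ((p %% 4 == 3)%N && odd (gcdn m u))) :
  let v := gcdn m u in
  let case1 := ((p %% 4 == 3)%N && odd v) in
  let n := if case1 then ((p ^ m + 1) * (p ^ m.-1 - 1))%N
           else ((p ^ m - 1) * (p ^ m.-1 + 1))%N in
  let w1 := ((p - 1) * p ^ (2 * m - 2))%N in
  let w2 := if case1 then ((p - 1) * (p ^ (2 * m - 2) - p ^ m.-1))%N
            else ((p - 1) * (p ^ (2 * m - 2) + p ^ m.-1))%N in
  let A1 := n in
  let A2 := if case1 then ((p ^ m + 1) * p ^ m.-1 * (p - 1))%N
            else ((p ^ m - 1) * p ^ m.-1 * (p - 1))%N in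
  let C := code F p m u in
  [/\ [/\ #|D2 F p m u| = n,
      (* length n, entries in F_p, F_p-linear, 2m-dimensional *)
      (forall c, c \in C -> size c = n /\ (forall x, x \in c -> x ^+ p = x)),
      (forall c d, c \in C -> d \in C -> addw c d \in C)
      & size C = (p ^ (2 * m))%N],
      (* two-weight with the given weight distribution *)
      (forall c, c \in C -> wt c \in [:: 0%N; w1; w2]),
      [/\ w1 != 0%N, w2 != 0%N & w1 != w2] &
      [/\ count (fun c => wt c == 0%N) C = 1%N,
          count (fun c => wt c == w1) C = A1 &
          count (fun c => wt c == w2) C = A2]].
Proof.
move=> v case1 n w1 w2 A1 A2 C.
have p1 := prime_gt1 hp.
pose r := (p ^ m.-1)%N.
have r0 : (0 < r)%N by rewrite expn_gt0 (ltnW p1).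
have rr : (p ^ (2 * m - 2) = r * r)%N.
  by rewrite -expnD addnn -mul2n -subn1 mulnBr.
have [cardD wQ0 wQ cardQ] := weights_of_polar_dual hchar hm hcard hodd hmv.
have E1 : w1 = ((p - 1) * (r * r))%N by rewrite /w1 rr.
have E2 : w2 = if case1 then ((p - 1) * (r * r - r))%N else ((p - 1) * (r * r + r))%N.
  by rewrite /w2 rr.
rewrite -E1 in wQ0; rewrite -/r -/v -/case1 -E2 in wQ.
have w1n : w1 != 0%N by rewrite E1 -lt0n !muln_gt0 r0 subn_gt0 p1.
have w2n : w2 != 0%N.
  rewrite E2 -lt0n; case: ifP => c1; rewrite muln_gt0 subn_gt0 p1 /=.
    (* [r * r - r] is positive only if [r > 1], that is [m > 1]. *)
    rewrite subn_gt0 ltn_Pmull //; case/orP: hdeg => [m1|]; last by rewrite -/v -/case1 c1.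
    by rewrite -(expn0 p) ltn_exp2l // -ltnS prednK.
  by rewrite addn_gt0 r0 orbT.
have w12 : w1 != w2.
  rewrite E1 E2; case: ifP => _; rewrite eqn_pmul2l ?subn_gt0 //.
    by rewrite neq_ltn ltn_subrL r0 muln_gt0 r0 orbT.
  by rewrite neq_ltn -{1}[(r * r)%N]addn0 ltn_add2l r0.
split; last split.
- split; first exact: cardD.
  + move=> c /codeP [ab ->]; split; first by rewrite size_cw.
    by move=> x; apply: cw_prime_subfield.
  + by move=> c d; apply: code_addw.
  + rewrite mul2n -addnn expnD.
    exact: (size_code hchar hm hcard hodd hmv w1n w2n wQ0 wQ).
- exact: (wt_code hchar hm hcard hodd hmv wQ0 wQ).
- by [].
- exact: (count_wt0 hchar hm hcard hodd hmv w1n w2n wQ0 wQ).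
- rewrite /A1 /n -cardD.
  exact: (count_wt1 hchar hm hcard hodd hmv w1n w2n w12 wQ0 wQ).
- rewrite /A2 -cardQ.
  exact: (count_wt2 hchar hm hcard hodd hmv w1n w2n w12 wQ0 wQ).
Qed.
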